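(* Let $q$ be a prime power, $n\geq 2$, $E=\mathbb{F}_q^n$, and $T=|\mathcal{L}(E)|$. Let $\mathcal{M}=(\mathcal{L}(E),\rho)$ be a $q$-matroid and let $p_{\mathcal{M}}=(\rho(X))_{X\in\mathcal{L}(E)\setminus\{\langle 0\rangle\}}\in\mathbb{R}^{T-1}$ be its corresponding point in the reduced $q$-rank polytope $\bar{\mathcal{P}}_q^n$. Then $p_{\mathcal{M}}$ is a vertex of $\bar{\mathcal{P}}_q^n$.
   Context: $\mathcal{L}(E)$ denotes the lattice of all $\mathbb{F}_q$-subspaces of $E$ ordered by inclusion. A $q$-rank function is a map $\rho:\mathcal{L}(E)\to\mathbb{R}$ with (R1) $0\le\rho(A)\le\dim(A)$, (R2) $A\le B\Rightarrow \rho(A)\le\rho(B)$, (R3) $\rho(A\cap B)+\rho(A+B)\le\rho(A)+\rho(B)$ for all $A,B\in\mathcal{L}(E)$; the pair $(\mathcal{L}(E),\rho)$ is a $q$-polymatroid, and a $q$-matroid if $\rho$ is integer-valued. The $q$-rank polytope $\mathcal{P}_q^n\subseteq\mathbb{R}^{T}$ (coordinates indexed by $\mathcal{L}(E)$) is the set of vectors $v=(v_X)_{X\in\mathcal{L}(E)}$ with $v\ge 0$, $v_X\le\dim X$ for all $X$, $v_X\le v_Y$ whenever $X\le Y$, and $v_{X+Y}+v_{X\cap Y}\le v_X+v_Y$ for all $X,Y$; i.e. the set of image vectors of $q$-rank functions. Since $v_{\langle 0\rangle}=0$ always, the reduced $q$-rank polytope $\bar{\mathcal{P}}_q^n\subseteq\mathbb{R}^{T-1}$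 is the image of $\mathcal{P}_q^n$ under deleting the coordinate indexed by $\langle 0\rangle$. *)

(* Defs.v *)
From HB Require Import structures.
From mathcomp Require Import all_boot all_order all_algebra.
From mathcomp Require Import classical_sets reals.

Set Implicit Arguments.
Unset Strict Implicit.
Unset Printing Implicit Defensive.

Import Order.TTheory GRing.Theory Num.Theory.

Local Open Scope classical_set_scope.
Local Open Scope ring_scope.

Import VectorInternalTheory.

(* Subspaces of a finite-dimensional space over a finite field are a subtype
   of the square matrices over that field, hence form a finite type. *)
HB.instance Definition _ (F : finFieldType) (vT : vectType F) :=
  [Countable of {vspace vT} by <:].
HB.instance Definition _ (F : finFieldType) (vT : vectType F) :=
  [Finite of {vspace vT} by <:].

(* L(E) for E = F^n. *)
Definition subspaces (F : finFieldType) (n : nat) : finType :=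
  {vspace 'rV[F]_n}.

(* L(E) \ {<0>}. *)
Definition nzsubspaces (F : finFieldType) (n : nat) : finType :=
  {X : subspaces F n | X != 0%VS}.

Fact card_nzsubspaces (F : finFieldType) (n : nat) :
  #|nzsubspaces F n| = (#|subspaces F n| - 1)%N.
Proof.
rewrite card_sig subn1 -(cardC1 (0%VS : subspaces F n)).
by apply: eq_card => X; rewrite !inE.
Qed.

Definition q_rank_function (R : realType) (F : finFieldType) (n : nat)
    (rho : subspaces F n -> R) : Prop :=
  [/\ forall A : subspaces F n, 0 <= rho A <= (\dim A)%:R,
      forall A B : subspaces F n, (A <= B)%VS -> rho A <= rho B
    & forall A B : subspaces F n,
        rho (A :&: B)%VS + rho (A + B)%VS <= rho A + rho B].

Definition q_matroid (R : realType) (F : finFieldType) (n : nat)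
    (rho : subspaces F n -> R) : Prop :=
  q_rank_function rho /\ forall A : subspaces F n, rho A \is a Num.int.

Definition q_rank_polytope (R : realType) (F : finFieldType) (n : nat) :
    set {ffun subspaces F n -> R} :=
  [set v | [/\ forall X : subspaces F n, 0 <= v X,
      forall X : subspaces F n, v X <= (\dim X)%:R,
      forall X Y : subspaces F n, (X <= Y)%VS -> v X <= v Y
    & forall X Y : subspaces F n,
        v (X + Y)%VS + v (X :&: Y)%VS <= v X + v Y]].

Definition delete_zero (R : realType) (F : finFieldType) (n : nat)
    (v : {ffun subspaces F n -> R}) : {ffun nzsubspaces F n -> R} :=
  [ffun X => v (val X)].

Definition reduced_q_rank_polytope (R : realType) (F : finFieldType)
    (n : nat) : set {ffun nzsubspaces F n -> R} :=
  @delete_zero R F n @` @q_rank_polytope R F n.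

Definition q_matroid_point (R : realType) (F : finFieldType) (n : nat)
    (rho : subspaces F n -> R) : {ffun nzsubspaces F n -> R} :=
  [ffun X => rho (val X)].

Definition dot (R : realType) (I : finType) (c x : {ffun I -> R}) : R :=
  \sum_(i : I) c i * x i.

(* G is the subset of P where some inequality c.x <= d valid on P is tight. *)
Definition face (R : realType) (I : finType) (P G : set {ffun I -> R}) : Prop :=
  exists (c : {ffun I -> R}) (d : R),
    (forall x, P x -> dot c x <= d) /\ G = P `&` [set x | dot c x = d].

Definition vertex (R : realType) (I : finType) (P : set {ffun I -> R})
    (p : {ffun I -> R}) : Prop :=
  face P [set p].

(* Main.v *)
Require Import Defs.
From HB Require Import structures.
From mathcomp Require Import all_boot all_order all_algebra.
From mathcomp Require Import classical_sets reals.
From mathcomp Require Import lra.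

(** Every subspace [X] contains an independent subspace [B X] (one with
    [rho (B X) = dim (B X)]) of the same rank as [X].  On the polytope the
    inequalities [v (B X) <= dim (B X)] and [v (B X) <= v X] are valid, and both
    are tight at [rho]; conversely, tightness of both forces [v X = rho X].
    Summing them over all nonzero [X] therefore gives a single valid
    inequality that is tight at [rho] only. *)

Import Order.TTheory GRing.Theory Num.Theory.
Local Open Scope classical_set_scope.
Local Open Scope ring_scope.

Lemma int_num_lt_le_add1 {R : realType} (a b : R) :
  a \is a Num.int -> b \is a Num.int -> a < b -> a + 1 <= b.
Proof.
move=> /intrP[x ->] /intrP[y ->]; rewrite ltr_int -lezD1 -(ler_int R).
by rewrite intrD.
Qed.

(** Matroid augmentation: take [I] independent in [X] of maximal dimension, then [Y] of maximal
    dimension between [I] and [X] with the rank of [I]. A vector of [X] outside [Y] would enlarge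
    [I] to a bigger independent space, so [Y = X]. *)
Lemma q_matroid_basis {R : realType} {F : finFieldType} {n : nat}
    (rho : subspaces F n -> R) (X : subspaces F n) :
  q_matroid rho ->
  exists B : subspaces F n, [/\ (B <= X)%VS, rho B = (\dim B)%:R & rho B = rho X].
Proof.
move=> [[bnd mono submod] rint].
have rho0 : rho 0%VS = (\dim (0%VS : subspaces F n))%:R.
  by apply/eqP; have := bnd 0%VS; rewrite dimv0 eq_le andbC.
pose indep (I : subspaces F n) := (I <= X)%VS && (rho I == (\dim I)%:R).
have indep0 : indep 0%VS by rewrite /indep sub0v rho0 eqxx.
have [I /andP[IX /eqP rI] maxI] := arg_maxnP (fun I : subspaces F n => \dim I) indep0.
pose spanned (Y : subspaces F n) := [&& (I <= Y)%VS, (Y <= X)%VS & rho Y == rho I].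
have spannedI : spanned I by rewrite /spanned subvv IX eqxx.
have [Y /and3P[IY YX /eqP rY] maxY] :=
  arg_maxnP (fun Y : subspaces F n => \dim Y) spannedI.
exists I; split => //; rewrite -rY; congr rho.
apply/eqP; rewrite eqEsubv YX /=; apply/subvP => x xX; apply: contraT => xY.
have lXx : (<[x]> <= X)%VS by rewrite -memvE.
have YxX : (Y + <[x]> <= X)%VS by rewrite subv_add YX.
have dimYx : (\dim Y < \dim (Y + <[x]>))%N.
  rewrite ltnNge; apply: contra xY => dle.
  have /eqP-> : Y == (Y + <[x]>)%VS by rewrite eqEdim addvSl.
  by rewrite memvE addvSr.
have ltYx : rho I < rho (Y + <[x]>)%VS.
  rewrite lt_neqAle -{2}rY mono ?addvSl // andbT eq_sym.
  apply/negP => /eqP e; have := maxY (Y + <[x]>)%VS.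
  rewrite /spanned e eqxx YxX (subv_trans IY (addvSl _ _)) => /(_ isT).
  by rewrite /= leqNgt dimYx.
(* Submodularity carries the rank jump at [Y] down to [I]: [I + <[x]>] and [Y] have sum [Y + <[x]>],
   and their intersection contains [I]. *)
have ltIx : rho I < rho (I + <[x]>)%VS.
  have := submod (I + <[x]>)%VS Y.
  rewrite -addvA (addvC <[x]>%VS) addvA (addv_idPr IY).
  have : rho I <= rho ((I + <[x]>) :&: Y)%VS by apply: mono; rewrite subv_cap addvSl.
  by rewrite rY; lra.
have dimIx : (\dim (I + <[x]>) <= (\dim I).+1)%N.
  rewrite (leq_trans (dimv_add_leqif _ _)) // dim_vline.
  by case: (x != 0); rewrite ?addn0 ?addn1.
(* Integrality enters here: the rank jumps by at least 1 while the dimension grows by at most 1. *)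
have geIx := int_num_lt_le_add1 _ _ (rint I) (rint _) ltIx.
have /andP[_ leIx] := bnd (I + <[x]>)%VS.
have rIx : rho (I + <[x]>)%VS = (\dim (I + <[x]>))%:R.
  apply/eqP; rewrite eq_le leIx (le_trans _ geIx) // rI natr1 ler_nat.
  exact: dimIx.
have := maxI (I + <[x]>)%VS; rewrite /indep subv_add IX lXx rIx eqxx => /(_ isT).
by rewrite /= -(ler_nat R) -rIx -rI leNgt ltIx.
Qed.

(** Coefficients of the sum of [2 * v (B X) - v X] over nonzero [X], collected by coordinate. *)
Definition tight_functional {R : realType} {F : finFieldType} {n : nat}
    (B : subspaces F n -> subspaces F n) : {ffun nzsubspaces F n -> R} :=
  [ffun Y => (\sum_(X : nzsubspaces F n | B (val X) == val Y) 2) - 1].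

(* The coordinate at <0> is absent from the reduced point, which is harmless
   because [v 0 = 0]. *)
Lemma dot_tight_functional {R : realType} {F : finFieldType} {n : nat}
    (B : subspaces F n -> subspaces F n) (v : {ffun subspaces F n -> R}) :
  v 0%VS = 0 ->
  dot (tight_functional B) (delete_zero v) =
  \sum_(X : nzsubspaces F n) (2 * v (B (val X)) - v (val X)).
Proof.
move=> v0; rewrite /dot sumrB.
under eq_bigr do rewrite !ffunE mulrBl mul1r big_distrl /=.
rewrite sumrB; congr (_ - _).
rewrite (exchange_big_dep predT) //=; apply: eq_bigr => X _.
have [B0|Bn0] := eqVneq (B (val X)) 0%VS.
  rewrite B0 v0 mulr0 big1 // => Y /eqP Y0.
  by rewrite -Y0 v0 mulr0.
by rewrite (big_pred1 (Sub (B (val X)) Bn0)) // => Y; rewrite eq_sym -val_eqE.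
Qed.

Theorem theorem3p8 (R : realType) (F : finFieldType) (n : nat)
    (hn : (2 <= n)%N) (rho : subspaces F n -> R) (hrho : q_matroid rho) :
  vertex (@reduced_q_rank_polytope R F n) (q_matroid_point rho).
Proof.
have /boolp.choice[B basisB] X := q_matroid_basis rho X hrho.
have polytope0 (v : {ffun subspaces F n -> R}) :
    q_rank_polytope v -> v 0%VS = 0.
  case=> v_ge0 v_le _ _; apply/eqP.
  by rewrite eq_le v_ge0 andbT (le_trans (v_le _)) // dimv0.
(* The sum of [v (B X) <= \dim (B X)] and [v (B X) - v X <= 0]. *)
have term_le (v : {ffun subspaces F n -> R}) (X : subspaces F n) :
    q_rank_polytope v -> 2 * v (B X) - v X <= rho X.
  case=> _ v_le v_mono _; have [BX rB <-] := basisB X.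
  by have := v_le (B X); have := v_mono _ _ BX; rewrite rB; lra.
pose r := [ffun X => rho X] : {ffun subspaces F n -> R}.
have rP : q_rank_polytope r.
  have [[bnd mono submod] _] := hrho.
  split=> [X|X|X Y XY|X Y]; rewrite !ffunE.
  - by have /andP[] := bnd X.
  - by have /andP[] := bnd X.
  - exact: mono.
  - by rewrite addrC; apply: submod.
have pE : q_matroid_point rho = delete_zero r by apply/ffunP => X; rewrite !ffunE.
exists (tight_functional B), (\sum_(X : nzsubspaces F n) rho (val X)); split.
  move=> _ [v vP <-]; rewrite dot_tight_functional; last exact: polytope0.
  by apply: ler_sum => X _; apply: term_le.
apply/seteqP; split=> [_ -> | _ [[v vP <-]] /=].
  split; first by exists r.
  rewrite /= pE dot_tight_functional; last exact: polytope0.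
  apply: eq_bigr => X _; rewrite !ffunE; have [_ _ ->] := basisB (val X).
  by rewrite mulr_natl mulr2n addrK.
rewrite dot_tight_functional; last exact: polytope0.
(* Nonnegative slacks with zero sum all vanish, so every summand is tight. *)
move/eqP; rewrite eq_sym -subr_eq0 -sumrB psumr_eq0; last first.
  by move=> X _; rewrite subr_ge0; apply: term_le.
move=> /allP tight; apply/ffunP => X; rewrite !ffunE.
have /eqP := tight X (mem_index_enum X).
have [_ v_le v_mono _] := vP; have [BX rB rBX] := basisB (val X).
by have := v_le (B (val X)); have := v_mono _ _ BX; rewrite -rB rBX; lra.
Qed.
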